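(* Let $\mathcal H$ be a real or complex Hilbert space and $\mathcal D\subseteq\mathcal H$ a linear subspace. The bounded symmetric operator $S:\mathcal D\to\mathcal H$, $\|S\|=1$, has a unique self-adjoint norm $1$ extension to $\mathcal H$ if and only if for every non-zero $g\in\mathcal D^\perp$ one has $$\sup\{|\langle Sf,g\rangle|^2:\ f\in\mathcal D,\ \|f\|^2-\|Sf\|^2\le1\}=+\infty.$$
   Context: $S:\mathcal D\to\mathcal H$ is symmetric if $\langle Sf,g\rangle=\langle f,Sg\rangle$ for all $f,g\in\mathcal D$; $\|S\|=\sup\{\|Sf\|: f\in\mathcal D,\ \|f\|\le1\}$. The subspace $\mathcal D$ is not assumed dense or closed. A self-adjoint norm $1$ extension of $S$ to $\mathcal H$ is an everywhere defined bounded self-adjoint operator $\widetilde S$ on $\mathcal H$ with $\|\widetilde S\|=1$ and $\widetilde Sf=Sf$ for all $f\in\mathcal D$. *)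

(* Defs.v *)
From HB Require Import structures.
From mathcomp Require Import all_boot all_order all_algebra.
From mathcomp Require Import complex.
From mathcomp Require Import all_classical all_reals all_analysis.
Set Implicit Arguments.
Unset Strict Implicit.
Unset Printing Implicit Defensive.
Import Order.TTheory GRing.Theory Num.Theory.

Local Open Scope classical_set_scope.
Local Open Scope ring_scope.

Variant scalar_kind := RealScalars | ComplexScalars.

Definition scalars (R : realType) (k : scalar_kind) : numFieldType :=
  match k with
  | RealScalars => R
  | ComplexScalars => R[i]
  end.

Definition scalar_conj (R : realType) (k : scalar_kind) :
    scalars R k -> scalars R k :=
  match k with
  | RealScalars => idfun
  | ComplexScalars => Num.conj
  end.

Definition real_part (R : realType) (k : scalar_kind) : scalars R k -> R :=
  match k with
  | RealScalars => idfun
  | ComplexScalars => @complex.Re R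
  end.

(* MathComp norms over R[i] take their (real, nonnegative) values in R[i];
   [rnorm] is the same norm read in R.  It applies both to vectors and to
   scalars. *)
Definition rnorm (R : realType) (k : scalar_kind)
    (V : normedZmodType (scalars R k)) (v : V) : R := real_part `|v|.

Section Subspace.
Context (K : nzRingType) (H : lmodType K) (D : submodClosed H).

Record subspace_type := SubspaceVector { vector_of : H; _ : vector_of \in D }.

HB.instance Definition _ := [isSub for vector_of].
HB.instance Definition _ := [Choice of subspace_type by <:].
HB.instance Definition _ := [SubChoice_isSubLmodule of subspace_type by <:].

End Subspace.

Section SubspaceNorm.
Context (K : numFieldType) (H : normedModType K) (D : submodClosed H).
Implicit Types f g : subspace_type D.

Let norm f : K := `|val f|.

Let ler_normD f g : norm (f + g) <= norm f + norm g.
Proof. by rewrite /norm GRing.valD Num.Theory.ler_normD. Qed.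

Let normr0_eq0 f : norm f = 0 -> f = 0.
Proof.
by move=> /Num.Theory.normr0_eq0 f0; apply/val_inj; rewrite f0 GRing.val0.
Qed.

Let normrMn f n : norm (f *+ n) = norm f *+ n.
Proof. by rewrite /norm raddfMn Num.Theory.normrMn. Qed.

Let normrN f : norm (- f) = norm f.
Proof. by rewrite /norm raddfN Num.Theory.normrN. Qed.

HB.instance Definition _ := Num.Zmodule_isNormed.Build K (subspace_type D)
  ler_normD normr0_eq0 normrMn normrN.

End SubspaceNorm.

Section Operators.
Context (R : realType) (k : scalar_kind).
Local Notation K := (scalars R k).

Definition opnorm (U V : normedZmodType K) (T : U -> V) : \bar R :=
  ereal_sup [set (rnorm (T f))%:E | f in [set f | rnorm f <= 1]].

Context (H : completeNormedModType K) (dot : {dot H for @scalar_conj R k}).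

Definition symmetric_on (D : submodClosed H)
    (S : subspace_type D -> H) : Prop :=
  forall f g : subspace_type D, dot (S f) (val g) = dot (val f) (S g).

Definition orthogonal_complement (D : submodClosed H) : set H :=
  [set g | forall f : subspace_type D, dot (val f) g = 0].

Definition is_adjoint (T T' : H -> H) : Prop :=
  forall f g, dot (T f) g = dot f (T' g).

(* For an everywhere defined T, finiteness of [opnorm T] is boundedness. *)
Definition selfadjoint_norm1_extension (D : submodClosed H)
    (S : subspace_type D -> H) (T : H -> H) : Prop :=
  [/\ linear T, is_adjoint T T, opnorm T = 1%E
    & forall f : subspace_type D, T (val f) = S f].

End Operators.

(* Main.v *)
(**
The theory is Krein's.  Put [A = 1 + S], a positive form on [D] with
[|A f|^2 <= 2 <f, A f>].  For [x] in [H], the vectors [f] of [D] nearly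
maximising [2 Re <x, A f> - <f, A f>] are approximate projections of [x] to [D]
for the energy seminorm, and [A f] converges along them to a vector [P x].
[P] is linear and symmetric, extends [A], satisfies [|P x|^2 <= 2 <x, P x>], and
[<x, P x>] is the supremum of [2 Re <x, A f> - <f, A f>]; so [P - 1] is a
self-adjoint contraction extending [S].

If [T1], [T2] are two extensions, Cauchy-Schwarz for the positive forms
[<x, y> - <T x, T y>] bounds [<S f, (T1 - T2) u>] by the square root of
[|f|^2 - |S f|^2], and [(T1 - T2) u] is orthogonal to [D].

Conversely, if [|<S f, g>|^2 <= M (|f|^2 - |S f|^2)] on [D] with [g] orthogonal
to [D], completing the square in the formula for [<x, P x>] gives
[<x, P x> + e |<x, g>|^2 <= 2 |x|^2] for small [e > 0], so adding the rank one
operator [e <., g> g] to [P - 1] yields a second extension.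
*)

Require Import Defs.
From mathcomp Require Import all_boot all_order all_algebra.
From mathcomp Require Import complex ring lra.
From mathcomp Require Import all_classical all_reals all_analysis.
Set Implicit Arguments.
Unset Strict Implicit.
Unset Printing Implicit Defensive.
Import Order.TTheory GRing.Theory Num.Theory.

Local Open Scope classical_set_scope.
Local Open Scope ring_scope.

(** * Real and complex scalars handled uniformly *)

Lemma rnorm_complex (R : realType) (a : scalars R ComplexScalars) :
  rnorm a = Num.sqrt (complex.Re a ^+ 2 + complex.Im a ^+ 2).
Proof. by have := normc_def a => /(congr1 (@complex.Re R)). Qed.

Section Scalars.
Context (R : realType) (k : scalar_kind).
Local Notation K := (scalars R k).
Local Notation conj := (@scalar_conj R k).
Local Notation re := (@real_part R k).

Definition of_real : R -> K :=
  match k with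
  | RealScalars => idfun
  | ComplexScalars => real_complex R
  end.

Lemma real_partD (a b : K) : re (a + b) = re a + re b.
Proof. by rewrite /real_part; move: a b; case: k => //= -[? ?] [? ?]. Qed.

Lemma real_partN (a : K) : re (- a) = - re a.
Proof. by rewrite /real_part; move: a; case: k => //= -[? ?]. Qed.

Lemma real_part0 : re 0 = 0.
Proof. by rewrite /real_part; case: k. Qed.

Lemma real_part1 : re 1 = 1.
Proof. by rewrite /real_part; case: k. Qed.

Lemma real_part_conj (a : K) : re (conj a) = re a.
Proof. by move: a; case: k => //= -[? ?]. Qed.

Lemma real_part_of_realM (r : R) (a : K) : re (of_real r * a) = r * re a.
Proof.
rewrite /real_part /of_real; move: a; case: k => //= -[x y].
by rewrite /= mul0r subr0.
Qed.

Lemma conjK : involutive conj.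
Proof. by case: k => //= a; rewrite conjCK. Qed.

Lemma rnorm_of_real (r : R) : rnorm (of_real r) = `|r|.
Proof.
rewrite /of_real; case: k => //.
by rewrite rnorm_complex /= expr0n addr0 sqrtr_sqr.
Qed.

Lemma normE (V : normedZmodType K) (v : V) : `|v| = of_real (rnorm v).
Proof.
rewrite /rnorm /real_part /of_real; move: V v; case: k => //= V v.
by rewrite RRe_real // normr_real.
Qed.

Lemma rnorm_ge0 (V : normedZmodType K) (v : V) : 0 <= rnorm v.
Proof.
rewrite /rnorm /real_part; move: V v; case: k => //= V v.
by have := normr_ge0 v; rewrite lecE /= => /andP[].
Qed.

Lemma of_real_ltE (a b : R) : (of_real a < of_real b) = (a < b).
Proof. by rewrite /of_real; case: k => //=; rewrite ltcR. Qed.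

Lemma of_real_leE (a b : R) : (of_real a <= of_real b) = (a <= b).
Proof. by rewrite /of_real; case: k => //=; rewrite lecR. Qed.

(** The order of [R[i]] forces a positive element to be real, so radii of balls can be read in
    [R]. *)
Lemma gt0_of_real (e : K) : 0 < e -> exists2 r : R, 0 < r & e = of_real r.
Proof.
rewrite /of_real; move: e; case: k => /= e e0; first by exists e.
have er := gtr0_real e0; exists (complex.Re e); last by rewrite RRe_real.
by rewrite -ltcR RRe_real.
Qed.

Lemma of_real0 : of_real 0 = 0.
Proof. by rewrite /of_real; case: k => //; rewrite rmorph0. Qed.

Lemma of_realD (a b : R) : of_real (a + b) = of_real a + of_real b.
Proof. by rewrite /of_real; case: k => //=; rewrite rmorphD. Qed.

Lemma of_realM (a b : R) : of_real (a * b) = of_real a * of_real b.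
Proof. by rewrite /of_real; case: k => //=; rewrite rmorphM. Qed.

Lemma of_realK (r : R) : re (of_real r) = r.
Proof. by rewrite /real_part /of_real; case: k. Qed.

Lemma rnormM (a b : K) : rnorm (a * b) = rnorm a * rnorm b.
Proof.
by apply: (can_inj of_realK); rewrite -normE normrM !normE of_realM.
Qed.

Lemma sqr_rnorm_scalar (a : K) : rnorm a ^+ 2 = re (conj a * a).
Proof.
move: a; case: k => a.
  by rewrite /rnorm /= -expr2 real_normK// num_real.
by case: a => x y; rewrite rnorm_complex sqr_sqrtr ?addr_ge0 ?sqr_ge0//=; ring.
Qed.

Lemma conj_mul (a : K) : conj a * a = of_real (rnorm a ^+ 2).
Proof.
rewrite sqr_rnorm_scalar /of_real /real_part; move: a; case: k => // -[x y].
by apply/eqP; rewrite eq_complex /= eqxx /=; apply/eqP; ring.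
Qed.

Lemma rnorm_conj (a : K) : rnorm (conj a) = rnorm a.
Proof.
move: a; case: k => // a.
by have := norm_conjC a => /(congr1 (@complex.Re R)).
Qed.

Lemma rnormD (V : normedZmodType K) (u v : V) :
  rnorm (u + v) <= rnorm u + rnorm v.
Proof. by rewrite -of_real_leE of_realD -!normE ler_normD. Qed.

Lemma rnormN (V : normedZmodType K) (v : V) : rnorm (- v) = rnorm v.
Proof. by rewrite /rnorm normrN. Qed.

Lemma rnorm0_eq0 (V : normedZmodType K) (v : V) : rnorm v = 0 -> v = 0.
Proof. by move=> v0; apply/normr0_eq0; rewrite normE v0 of_real0. Qed.

Lemma rnormZ (V : normedModType K) (a : K) (v : V) :
  rnorm (a *: v) = rnorm a * rnorm v.
Proof. by apply: (can_inj of_realK); rewrite -normE normrZ !normE of_realM. Qed.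

End Scalars.

(** * Two elementary real inequalities *)

Section RealInequalities.
Context (R : realType).
Implicit Types a b e p q C : R.

(** Take [t = b / a]; if [a = 0], a linear function of [t] bounded above vanishes. This also serves
    Cauchy-Schwarz for degenerate forms. *)
Lemma discriminant_le a b e : 0 <= a -> 0 <= e ->
  (forall t, 2 * t * b <= t ^+ 2 * a + e) -> b ^+ 2 <= e * a.
Proof.
move=> a0 e0 tP; have [a_eq0|an0] := eqVneq a 0.
  rewrite a_eq0 mulr0; have [->|b0] := eqVneq b 0; first by rewrite expr0n.
  (* With this [t] the left side is [e + 1], which exceeds [e]. *)
  have := tP ((e + 1) / (2 * b)).
  have -> : 2 * ((e + 1) / (2 * b)) * b = e + 1 by field.
  by rewrite a_eq0 mulr0 add0r => ?; lra.
have ap : 0 < a by rewrite lt_def an0.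
have := tP (b / a); rewrite -(ler_pM2r ap).
have -> : 2 * (b / a) * b * a = 2 * b ^+ 2 by field.
have -> : ((b / a) ^+ 2 * a + e) * a = b ^+ 2 + e * a by field.
by move=> ?; lra.
Qed.

(** Passage to the limit [e -> 0]; the restriction [e <= 1] lets terms in [e ^+ 2] be absorbed into
    [C * e]. *)
Lemma ler_linear_eps p q C :
  (forall e, 0 < e -> e <= 1 -> p <= q + C * e) -> p <= q.
Proof.
move=> H; apply/ler_addgt0Pr => e e0.
pose C' := `|C| + 1; have C'0 : 0 < C' by rewrite ltr_wpDl.
pose d := Num.min 1 (e / C').
have d0 : 0 < d by rewrite lt_min ltr01 divr_gt0.
have d1 : d <= 1 by rewrite ge_min lexx.
apply: (le_trans (H _ d0 d1)); rewrite lerD2l.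
apply: (@le_trans _ _ (C' * d)).
  by rewrite ler_pM2r// (le_trans (ler_norm _))// lerDl.
by rewrite -ler_pdivlMl// mulrC ge_min lexx orbT.
Qed.

End RealInequalities.

(** * The inner product and its real part *)

Section InnerProduct.
Context (R : realType) (k : scalar_kind).
Local Notation K := (scalars R k).
Local Notation conj := (@scalar_conj R k).
Context (H : completeNormedModType K) (dot : {dot H for conj}).
Context (norm_dot : forall x : H, `|x| ^+ 2 = dot x x).
Implicit Types x y z : H.

Lemma dotC x y : dot x y = conj (dot y x).
Proof. by have := hermitian_subproof (s := dot) x y; rewrite expr0 mul1r. Qed.

Lemma dotDl x y z : dot (x + y) z = dot x z + dot y z.
Proof. exact: linearDl. Qed.

Lemma dotNl x z : dot (- x) z = - dot x z.
Proof. exact: linearNl. Qed.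

Lemma dotBr x y z : dot z (x - y) = dot z x - dot z y.
Proof. exact: linearBr. Qed.

Lemma dotZl c x y : dot (c *: x) y = c * dot x y.
Proof. by rewrite linearZl_LR. Qed.

Lemma dotZr c x y : dot x (c *: y) = conj c * dot x y.
Proof. by rewrite linearZr_LR. Qed.

(** The real part keeps all estimates in [R]; rescaling [x] by scalars recovers the full product. *)
Definition ip x y : R := real_part (dot x y).

Lemma ipC x y : ip x y = ip y x.
Proof. by rewrite /ip dotC real_part_conj. Qed.

Lemma ipDl x y z : ip (x + y) z = ip x z + ip y z.
Proof. by rewrite /ip dotDl real_partD. Qed.

Lemma ipNl x z : ip (- x) z = - ip x z.
Proof. by rewrite /ip dotNl real_partN. Qed.

Lemma ipDr x y z : ip z (x + y) = ip z x + ip z y.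
Proof. by rewrite !(ipC z) ipDl. Qed.

Lemma ipNr x z : ip z (- x) = - ip z x.
Proof. by rewrite !(ipC z) ipNl. Qed.

Lemma ipBl x y z : ip (x - y) z = ip x z - ip y z.
Proof. by rewrite ipDl ipNl. Qed.

Lemma ipBr x y z : ip z (x - y) = ip z x - ip z y.
Proof. by rewrite ipDr ipNr. Qed.

Lemma ip0l x : ip 0 x = 0.
Proof. by rewrite /ip linear0l real_part0. Qed.

Lemma ipZl (r : R) x y : ip (of_real k r *: x) y = r * ip x y.
Proof. by rewrite /ip dotZl real_part_of_realM. Qed.

Lemma ipZr (r : R) x y : ip y (of_real k r *: x) = r * ip y x.
Proof. by rewrite !(ipC y) ipZl. Qed.

Lemma ipZ_conj c x y : ip (c *: x) y = ip x (conj c *: y).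
Proof. by rewrite /ip dotZl dotZr conjK. Qed.

Lemma ip_sqr x : ip x x = rnorm x ^+ 2.
Proof.
by rewrite /ip -norm_dot normE expr2 -of_realM of_realK.
Qed.

Lemma ip_ge0 x : 0 <= ip x x.
Proof. by rewrite ip_sqr sqr_ge0. Qed.

Definition ipE := (ipDl, ipDr, ipNl, ipNr, ipZl, ipZr).

(* Apply the hypothesis with [c] the conjugate of [dot x y]. *)
Lemma rnorm_dot_le x y (C : R) :
  (forall c : K, ip (c *: x) y ^+ 2 <= C * rnorm c ^+ 2) ->
  rnorm (dot x y) ^+ 2 <= C.
Proof.
move=> xyC.
have [->|d0] := eqVneq (rnorm (dot x y)) 0.
  rewrite expr0n /=; apply: le_trans (sqr_ge0 (ip (1 *: x) y)) _.
  by rewrite (le_trans (xyC 1))// /rnorm normr1 real_part1 expr1n mulr1.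
have := xyC (conj (dot x y)); rewrite /ip dotZl -sqr_rnorm_scalar rnorm_conj.
by rewrite [leLHS]expr2 ler_pM2r// exprn_gt0// lt_def d0 rnorm_ge0.
Qed.

Lemma ip_le x y : ip x y <= rnorm x * rnorm y.
Proof.
apply: (le_trans (ler_norm _)).
rewrite -(@ler_pXn2r _ 2)// ?nnegrE ?mulr_ge0 ?rnorm_ge0//.
rewrite real_normK ?num_real// exprMn -!ip_sqr; apply: discriminant_le => //.
- exact: ip_ge0.
- exact: ip_ge0.
move=> t; have := ip_ge0 (x - of_real k t *: y).
rewrite !ipE (ipC y x) => ?; nra.
Qed.

Lemma ip_norm_le x y : `|ip x y| <= rnorm x * rnorm y.
Proof.
by rewrite ler_norml ip_le andbT lerNl -ipNl (le_trans (ip_le _ _))//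
  /rnorm normrN.
Qed.

Lemma rnorm_dot x y : rnorm (dot x y) <= rnorm x * rnorm y.
Proof.
rewrite -(@ler_pXn2r _ 2)// ?nnegrE ?mulr_ge0 ?rnorm_ge0//.
apply: rnorm_dot_le => c; rewrite -(real_normK (num_real (ip _ _))).
rewrite -exprMn ler_pXn2r ?nnegrE ?mulr_ge0 ?rnorm_ge0//.
by rewrite (le_trans (ip_norm_le _ _))// rnormZ -mulrA mulrC.
Qed.

Lemma linear_fun0 (T : H -> H) : linear T -> T 0 = 0.
Proof.
by move=> lT; have := lT (- 1) 0 0; rewrite scaler0 addr0 scaleN1r addNr.
Qed.

Lemma linear_funZ (T : H -> H) c x : linear T -> T (c *: x) = c *: T x.
Proof. by move=> lT; have := lT c x 0; rewrite !addr0 linear_fun0// addr0. Qed.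

(* Testing on [c *: x] recovers the scalar product from its real part. *)
Lemma is_adjoint_ip (T : H -> H) : linear T ->
  (forall x y, ip (T x) y = ip x (T y)) -> is_adjoint dot T T.
Proof.
move=> lT sT x y; apply/eqP; rewrite -subr_eq0; apply/eqP/rnorm0_eq0/eqP.
rewrite -sqrf_eq0 sqr_rnorm_scalar; set c := conj _.
have := sT (c *: x) y; rewrite (linear_funZ _ _ lT) /ip !dotZl => sTc.
by rewrite mulrBr real_partD real_partN sTc subrr.
Qed.

End InnerProduct.

(** * Krein extension of a positive form given on a subspace *)

Section PositiveExtension.
Context (R : realType) (k : scalar_kind).
Local Notation K := (scalars R k).
Context (H : completeNormedModType K) (dot : {dot H for @scalar_conj R k}).
Context (norm_dot : forall x : H, `|x| ^+ 2 = dot x x).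
Local Notation ip := (ip dot).
Context (D : submodClosed H) (A : {linear subspace_type D -> H}).
Context (A_sym : forall f h, ip (A f) (val h) = ip (val f) (A h)).
Context (A_le : forall f, ip (A f) (A f) <= 2 * ip (val f) (A f)).
Implicit Types (x y : H) (f h : subspace_type D) (e : R).

Definition energy f : R := Num.sqrt (ip (val f) (A f)).
Local Notation s := energy.

Lemma energy_ge0 f : 0 <= s f.
Proof. exact: sqrtr_ge0. Qed.

Lemma energy_sqr f : s f ^+ 2 = ip (val f) (A f).
Proof.
by rewrite sqr_sqrtr//; have := A_le f; have := ip_ge0 norm_dot (A f); lra.
Qed.

(** [A_le] gives the square root of 2 as constant; the coarser 2 avoids the root. *)
Lemma rnorm_le_energy f : rnorm (A f) <= 2 * s f.
Proof.
rewrite -(@ler_pXn2r _ 2)// ?nnegrE ?mulr_ge0 ?rnorm_ge0 ?energy_ge0//.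
rewrite -(ip_sqr norm_dot) exprMn energy_sqr.
by have := A_le f; have := ip_ge0 norm_dot (A f); lra.
Qed.

Lemma energyZ c f : s (c *: f) = rnorm c * s f.
Proof.
rewrite /s GRing.valZ linearZ /= ipC ipZ_conj scalerA conj_mul ipZr ipC.
by rewrite sqrtrM ?sqr_ge0// sqrtr_sqr ger0_norm// rnorm_ge0.
Qed.

(* [f] is an approximate projection of [x] to [D] for the energy form. *)
Definition near_projection x f e :=
  forall h, `|ip (x - val f) (A h)| <= e * s h.

(** [phi] is bounded above because [2 x - A f] has nonnegative square norm. If [phi f] is within
    [e ^+ 2] of the supremum, moving [f] by [t h] gains at most [e ^+ 2]; the discriminant of this
    quadratic inequality in [t] gives the claim. *)
Lemma near_projection_exists x e : 0 < e -> exists f, near_projection x f e.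
Proof.
move=> e0.
pose phi f := 2 * ip x (A f) - ip (val f) (A f).
have phi_le f : phi f <= 2 * ip x x.
  have := ip_ge0 norm_dot (of_real k 2 *: x - A f); rewrite !ipE.
  by have := A_le f; rewrite /phi (ipC dot (A f) x); lra.
have supP : has_sup (range phi).
  split; first by exists (phi 0), 0.
  by exists (2 * ip x x) => _ [f _ <-].
have e20 : 0 < e ^+ 2 by rewrite exprn_gt0.
have [_ [f _ <-] fP] := sup_adherent e20 supP.
exists f => h.
rewrite -(@ler_pXn2r _ 2)// ?nnegrE ?mulr_ge0 ?energy_ge0 ?(ltW e0)//.
rewrite real_normK ?num_real// exprMn.
apply: discriminant_le; rewrite ?sqr_ge0//.
move=> t.
have : phi (f + of_real k t *: h) <= sup (range phi).
  by apply: sup_upper_bound => //; exists (f + of_real k t *: h).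
rewrite energy_sqr /phi GRing.valD GRing.valZ linearD linearZ !ipE.
have := A_sym f h; rewrite (ipC dot (A f)) => ->.
by move: fP; rewrite /phi; lra.
Qed.

Lemma near_projection_le x f e e' :
  e <= e' -> near_projection x f e -> near_projection x f e'.
Proof.
by move=> ee' xf h; rewrite (le_trans (xf h))// ler_wpM2r// energy_ge0.
Qed.

Lemma near_projection_linear c x x' f f' e e' :
  near_projection x f e -> near_projection x' f' e' ->
  near_projection (c *: x + x') (c *: f + f') (rnorm c * e + e').
Proof.
move=> xf xf' h; rewrite GRing.valD GRing.valZ opprD addrACA -scalerBr ipDl.
rewrite ipZ_conj -linearZ /= (le_trans (ler_normD _ _))// mulrDl lerD//.
rewrite (le_trans (xf _))// energyZ rnorm_conj; lra.
Qed.

(** Tested on [h = f], the hypothesis reads [s f ^+ 2 <= e * s f]. *)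
Lemma near_projection0 f e : 0 <= e -> near_projection 0 f e -> s f <= e.
Proof.
move=> e0 /(_ f); rewrite sub0r ipNl -energy_sqr normrN ger0_norm ?sqr_ge0//.
have := energy_ge0 f; rewrite le_eqVlt => /predU1P[<-//|sf0].
by rewrite expr2 ler_pM2r.
Qed.

(** Testing on [h = f] gives [s f ^+ 2 <= ip x (A f) + e * s f], and [rnorm (A f) <= 2 * s f]. *)
Lemma near_projection_energy x f e : 0 <= e ->
  near_projection x f e -> s f <= 2 * rnorm x + e.
Proof.
move=> e0 /(_ f).
have := energy_ge0 f; rewrite le_eqVlt => /predU1P[<- _|sf0].
  by rewrite addr_ge0// mulr_ge0// rnorm_ge0.
rewrite ipBl -energy_sqr => xf; rewrite -(ler_pM2r sf0).
have := ip_le norm_dot x (A f); have := rnorm_le_energy f.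
have := rnorm_ge0 x.
move: xf; rewrite ler_norml => /andP[xf _].
nra.
Qed.

(* The graph of the minimal (Krein) extension: [y] is the limit of the values
   of [A] along approximate projections of [x]. *)
Definition krein_graph x y := forall e, 0 < e ->
  exists2 f, rnorm (A f - y) <= e & near_projection x f e.

Lemma krein_graph_exists x : exists y, krein_graph x y.
Proof.
have /choice[f fP] n := near_projection_exists x (harmonic_gt0 (R := R) n).
have fB n m : rnorm (A (f n) - A (f m)) <= 2 * (harmonic n + harmonic m).
  rewrite -linearB /= (le_trans (rnorm_le_energy _))// ler_pM2l//.
  (* [f n - f m] is a near projection of 0, the two errors being added. *)
  apply: near_projection0; first by rewrite addr_ge0// harmonic_ge0.
  move=> h; rewrite sub0r GRing.valB opprB.
  have -> : val (f m) - val (f n) = (x - val (f n)) - (x - val (f m)).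
    by rewrite opprB [RHS]addrC addrA subrK.
  by rewrite ipBl (le_trans (ler_normB _ _))// mulrDl lerD// fP.
have : cvg ((A \o f) @ \oo).
  apply/cauchy_cvgP/cauchy_exP => _ /gt0_of_real[r r0 ->].
  (* Two harmonic terms below [r / 4] make the bound [fB] less than [r]. *)
  have r4 : 0 < r / 4 by rewrite divr_gt0.
  have [N _ NP] := near_infty_natSinv_lt (PosNum r4).
  exists (A (f N)); exists N => // n /= Nn.
  rewrite -ball_normE /ball_ /= normE of_real_ltE (le_lt_trans (fB _ _))//.
  have := NP _ Nn; have := NP N (leqnn _); rewrite /harmonic /=.
  by set a := N.+1%:R^-1; set b := n.+1%:R^-1 => ? ?; lra.
move=> /cvg_ex[y yP]; exists y => e e0.
have e0' : 0 < of_real k e.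
  by have := of_real_ltE k 0 e; rewrite of_real0 e0.
move/cvgrPdist_lt : yP => /(_ _ e0') yP.
have [n [ny ne]] := filter_ex (filterI yP (near_infty_natSinv_lt (PosNum e0))).
exists (f n); first by rewrite -rnormN opprB -(of_real_leE k) -normE ltW.
exact: near_projection_le (ltW ne) (fP n).
Qed.

Lemma krein_graph_linear c x x' y y' :
  krein_graph x y -> krein_graph x' y' ->
  krein_graph (c *: x + x') (c *: y + y').
Proof.
move=> xy xy' e e0.
have c0 := rnorm_ge0 c.
pose d := e / (rnorm c + 1).
have d0 : 0 < d by rewrite divr_gt0//; lra.
have dE : rnorm c * d + d = e by rewrite /d; field; lra.
have [f fy xf] := xy _ d0; have [f' fy' xf'] := xy' _ d0.
exists (c *: f + f'); last by rewrite -dE; exact: near_projection_linear.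
rewrite linearP opprD addrACA -scalerBr (le_trans (rnormD _ _))// rnormZ -dE.
by rewrite lerD// ler_wpM2l.
Qed.

(** A near projection [f] of 0 has energy at most [e], so [A f] has norm at most [2 e], and [y] at
    most [3 e]. *)
Lemma krein_graph0 y : krein_graph 0 y -> y = 0.
Proof.
move=> yP; apply/rnorm0_eq0/eqP; rewrite eq_le rnorm_ge0 andbT.
apply: (@ler_linear_eps _ _ _ 3) => e e0 _; rewrite add0r.
have [f fy /(near_projection0 (ltW e0)) fe] := yP _ e0.
have -> : y = A f - (A f - y) by rewrite opprB addrC subrK.
rewrite (le_trans (rnormD _ _))// rnormN.
by have := rnorm_le_energy f; lra.
Qed.

Lemma krein_graph_fun x y y' : krein_graph x y -> krein_graph x y' -> y = y'.
Proof.
move=> xy xy'; have := krein_graph_linear (- 1) xy' xy.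
rewrite !scaleN1r !(addrC (- _)) subrr => /krein_graph0/eqP.
by rewrite subr_eq0 => /eqP.
Qed.

Lemma krein_graph_val f : krein_graph (val f) (A f).
Proof.
move=> e e0; exists f; first by rewrite subrr /rnorm normr0 real_part0 ltW.
by move=> h; rewrite subrr (ip0l dot) normr0 mulr_ge0 ?energy_ge0 ?ltW.
Qed.

(** With near projections [f], [f'] of [x], [x'], both sides are close to
    [ip (A f) (val f') = ip (val f) (A f')]; the energy bound makes the errors linear in [e]. *)
Lemma krein_graph_sym x x' y y' :
  krein_graph x y -> krein_graph x' y' -> ip y x' = ip x y'.
Proof.
suff le a a' b b' : krein_graph a b -> krein_graph a' b' -> ip b a' <= ip a b'.
  move=> xy xy'; apply/eqP; rewrite eq_le le//=.
  by rewrite (ipC dot x) (ipC dot y) le.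
move=> ab ab'.
apply: (@ler_linear_eps _ _ _
  (rnorm a' + rnorm a + (2 * rnorm a + 1) + (2 * rnorm a' + 1))).
move=> e e0 e1.
have [f fb af] := ab _ e0; have [f' fb' af'] := ab' _ e0.
have := ip_norm_le norm_dot (A f - b) a'; rewrite ler_norml ipBl => /andP[h1 _].
have := ip_norm_le norm_dot a (A f' - b').
rewrite ler_norml ipBr => /andP[_ h2].
have := af' f; rewrite ler_norml ipBl => /andP[_ h3].
have := af f'; rewrite ler_norml ipBl => /andP[h4 _].
have := near_projection_energy (ltW e0) af.
have := near_projection_energy (ltW e0) af'.
have := A_sym f f'.
rewrite (ipC dot a' (A f)) (ipC dot (val f') (A f)) in h3.
have := rnorm_ge0 a; have := rnorm_ge0 a'.
nra.
Qed.

(** For a near projection [f], [ip x (A f)] is close both to [ip x y] and to [ip (val f) (A f)]. *)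
Lemma krein_graph_approx x y e : krein_graph x y -> 0 < e -> exists f,
  ip x y <= 2 * ip x (A f) - ip (val f) (A f) + e.
Proof.
move=> xy e0.
pose C := rnorm x + (2 * rnorm x + 1) + 1.
have x0 := rnorm_ge0 x.
pose d := Num.min 1 (e / C).
have C0 : 0 < C by rewrite /C; lra.
have d0 : 0 < d by rewrite lt_min ltr01 divr_gt0.
have d1 : d <= 1 by rewrite ge_min lexx.
have dC : C * d <= e by rewrite -ler_pdivlMl// mulrC ge_min lexx orbT.
have [f fy xf] := xy _ d0; exists f.
have := ip_norm_le norm_dot x (A f - y); rewrite ler_norml ipBr => /andP[h1 _].
have := xf f; rewrite ler_norml ipBl => /andP[h2 _].
have := near_projection_energy (ltW d0) xf => h3.
rewrite /C in dC.
nra.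
Qed.

Lemma krein_graph_le x y : krein_graph x y -> ip y y <= 2 * ip x y.
Proof.
move=> xy.
apply: (@ler_linear_eps _ _ _
  (2 * rnorm y + 2 * (rnorm x + (2 * rnorm x + 1)))).
move=> e e0 e1.
have [f fy xf] := xy _ e0.
have := ip_norm_le norm_dot x (A f - y); rewrite ler_norml ipBr => /andP[_ h1].
have := ip_norm_le norm_dot (A f - y) y; rewrite ler_norml => /andP[h5 _].
(* Positivity gives [ip (A f) (A f) >= 2 * ip (A f) y - ip y y], which is nearly [ip y y]. *)
have := ip_ge0 norm_dot (A f - y); rewrite !ipE.
have := xf f; rewrite ler_norml ipBl => /andP[h2 _].
have := near_projection_energy (ltW e0) xf => h3.
have := A_le f.
have := rnorm_ge0 x.
have := rnorm_ge0 y.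
rewrite !ipE in h5; rewrite (ipC dot y (A f)).
nra.
Qed.

(* The last clause says that [P] is minimal among the positive symmetric
   extensions of [A]. *)
Lemma krein_extension : exists P : H -> H,
  [/\ linear P, forall x y, ip (P x) y = ip x (P y),
      forall f, P (val f) = A f,
      forall x, ip (P x) (P x) <= 2 * ip x (P x)
    & forall x e, 0 < e -> exists f,
        ip x (P x) <= 2 * ip x (A f) - ip (val f) (A f) + e].
Proof.
have /choice[P PP] := krein_graph_exists.
exists P; split.
- by move=> c x y; apply: krein_graph_fun (PP _) _; exact: krein_graph_linear.
- by move=> x y; apply: krein_graph_sym.
- by move=> f; apply: krein_graph_fun (PP _) _; exact: krein_graph_val.
- by move=> x; apply: krein_graph_le.
- by move=> x e e0; apply: krein_graph_approx (PP x) e0.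
Qed.

End PositiveExtension.

(** * Infinite suprema as unboundedness *)

Lemma ereal_sup_image_pinfty (R : realType) (T : Type) (P : set T)
    (F : T -> R) :
  ereal_sup [set (F f)%:E | f in P] = +oo%E <->
  ~ exists M, forall f, P f -> F f <= M.
Proof.
split=> [supP [M FM]|unbounded].
  suff : (ereal_sup [set (F f)%:E | f in P] <= M%:E)%E by rewrite supP.
  by apply: ge_ereal_sup => _ [f Pf <-]; rewrite lee_fin FM.
case supE : (ereal_sup _) => [M|//|]; exfalso; apply: unbounded.
  exists M => f Pf; rewrite -lee_fin -supE.
  by apply: ereal_sup_ubound; exists f.
(* The supremum is [-oo] only if [P] is empty, where any bound serves. *)
exists 0 => f Pf; suff : ((F f)%:E <= -oo)%E by [].
by rewrite -supE; apply: ereal_sup_ubound; exists f.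
Qed.

(** * Contractions and positive forms *)

Section Contractions.
Context (R : realType) (k : scalar_kind).
Local Notation K := (scalars R k).

(** Homogeneity is a hypothesis on norms so that both [H] and the subspace [D] qualify as domain.
    Dividing by [rnorm u + e] avoids the case [u = 0]. *)
Lemma opnorm1_contraction (U V : normedZmodType K) (T : U -> V) :
  (forall (r : R) u, exists2 u', rnorm u' = `|r| * rnorm u &
    rnorm (T u') = `|r| * rnorm (T u)) ->
  opnorm T = 1%E -> forall u, rnorm (T u) <= rnorm u.
Proof.
move=> TZ T1 u; apply/ler_addgt0Pr => e e0.
have u0 := rnorm_ge0 u; have ue : 0 < rnorm u + e by lra.
have [u' nu' nTu'] := TZ (rnorm u + e)^-1 u.
move: nu' nTu'; rewrite gtr0_norm ?invr_gt0// => nu' nTu'.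
have : ((rnorm (T u'))%:E <= opnorm T)%E.
  apply: ereal_sup_ubound; exists u' => //=.
  by rewrite nu' ler_pdivrMl// mulr1 lerDl ltW.
by rewrite T1 lee_fin nTu' ler_pdivrMl// mulr1.
Qed.

Context (H : completeNormedModType K) (dot : {dot H for @scalar_conj R k}).
Context (norm_dot : forall x : H, `|x| ^+ 2 = dot x x).
Local Notation ip := (ip dot).

(* Cauchy-Schwarz for the form of [1 - T^* T]. *)
Lemma defect_cauchy_schwarz (T : H -> H) x y : linear T ->
  (forall x, rnorm (T x) <= rnorm x) ->
  (ip x y - ip (T x) (T y)) ^+ 2 <=
  (ip x x - ip (T x) (T x)) * (ip y y - ip (T y) (T y)).
Proof.
move=> lT Tle.
have defect_ge0 z : 0 <= ip z z - ip (T z) (T z).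
  by rewrite !(ip_sqr norm_dot) subr_ge0 ler_pXn2r ?nnegrE ?rnorm_ge0.
apply: discriminant_le => // t.
have := defect_ge0 (of_real k (- t) *: y + x); rewrite lT !ipE.
rewrite (ipC dot y x) (ipC dot (T y) (T x)); lra.
Qed.

(* Cauchy-Schwarz for the form of [P], at [x] and [P x]. *)
Lemma form_bound_contraction (P : H -> H) : linear P ->
  (forall x y, ip (P x) y = ip x (P y)) ->
  (forall x, 0 <= ip x (P x)) -> (forall x, ip x (P x) <= 2 * ip x x) ->
  forall x, ip (P x) (P x) <= 2 * ip x (P x).
Proof.
move=> lP sP P0 P2 x.
have /discriminant_le : forall t, 2 * t * ip (P x) (P x) <=
    t ^+ 2 * ip (P x) (P (P x)) + ip x (P x).
  move=> t; have := P0 (of_real k (- t) *: P x + x); rewrite lP !ipE.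
  by rewrite -(sP x (P x)); lra.
move=> /(_ (P0 _) (P0 _)) h.
have := ip_ge0 norm_dot (P x); rewrite le_eqVlt => /predU1P[<-|Px0].
  by rewrite mulr_ge0.
rewrite -(ler_pM2r Px0) -expr2 (le_trans h)//.
have := P2 (P x); have := P0 x; nra.
Qed.

Lemma shift_contraction (P : H -> H) :
  (forall x, ip (P x) (P x) <= 2 * ip x (P x)) ->
  forall x, rnorm (P x - x) <= rnorm x.
Proof.
move=> Ple x; rewrite -(@ler_pXn2r _ 2)// ?nnegrE ?rnorm_ge0//.
rewrite -!(ip_sqr norm_dot) !ipE (ipC dot (P x) x); have := Ple x; lra.
Qed.

(** * Self-adjoint extensions of [S] *)

Section Extension.
Context (D : submodClosed H) (S : {linear subspace_type D -> H}).
Context (S_symmetric : symmetric_on dot S).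
Context (S_norm1 : opnorm S = 1%E).
Implicit Types (f : subspace_type D) (g x y : H).

Definition defect f := rnorm f ^+ 2 - rnorm (S f) ^+ 2.

Lemma defectE f :
  defect f = ip (val f) (val f) - ip (S f) (S f).
Proof. by rewrite !(ip_sqr norm_dot). Qed.

Lemma rnorm_subspaceZ c f : rnorm (c *: f) = rnorm c * rnorm f.
Proof. exact: (rnormZ c (val f)). Qed.

Lemma S_contraction f : rnorm (S f) <= rnorm f.
Proof.
apply: opnorm1_contraction S_norm1 f => r f; exists (of_real k r *: f).
  by rewrite rnorm_subspaceZ rnorm_of_real.
by rewrite linearZ rnormZ rnorm_of_real.
Qed.

Lemma defect_ge0 f : 0 <= defect f.
Proof. by rewrite subr_ge0 ler_pXn2r ?nnegrE ?rnorm_ge0 ?S_contraction. Qed.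

Lemma defectZ c f : defect (c *: f) = rnorm c ^+ 2 * defect f.
Proof.
by rewrite /defect rnorm_subspaceZ [S _]linearZ rnormZ !exprMn mulrBr.
Qed.

Lemma extension_contraction T : selfadjoint_norm1_extension dot S T ->
  forall x, rnorm (T x) <= rnorm x.
Proof.
move=> [lT _ T1 _]; apply: opnorm1_contraction T1 => r x.
exists (of_real k r *: x); first by rewrite rnormZ rnorm_of_real.
by rewrite (linear_funZ _ _ lT) rnormZ rnorm_of_real.
Qed.

Lemma contraction_extension T : linear T ->
  (forall x y, ip (T x) y = ip x (T y)) ->
  (forall x, rnorm (T x) <= rnorm x) -> (forall f, T (val f) = S f) ->
  selfadjoint_norm1_extension dot S T.
Proof.
move=> lT sT Tle TS; split=> //; first exact: is_adjoint_ip.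
apply/eqP; rewrite eq_le; apply/andP; split.
  by apply: ge_ereal_sup => _ [x x1 <-]; rewrite lee_fin (le_trans (Tle _)).
(* The norm is not below 1 because [T] already attains the values of [S] on [D]. *)
rewrite -S_norm1; apply: ereal_sup_le => _ [f f1 <-].
by exists (val f); rewrite ?TS.
Qed.

(** For [A = 1 + S], the inequality [A_le] amounts to [rnorm (S f) <= rnorm f]. *)
Lemma extension_krein : exists P : H -> H,
  [/\ linear P, forall x y, ip (P x) y = ip x (P y),
      forall f, P (val f) = val f + S f,
      forall x, ip (P x) (P x) <= 2 * ip x (P x)
    & forall x e, 0 < e -> exists f,
        ip x (P x) <= 2 * ip x (val f + S f) - ip (val f) (val f + S f) + e].
Proof.
have S_sym f h : ip (S f) (val h) = ip (val f) (S h).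
  by rewrite /ip S_symmetric.
apply: (krein_extension norm_dot (A := val \+ S)) => [f h|f] /=.
  by rewrite !ipE S_sym.
have := defect_ge0 f; rewrite defectE !ipE (ipC dot (S f) (val f)); lra.
Qed.

Lemma extension_of_form P : linear P ->
  (forall x y, ip (P x) y = ip x (P y)) ->
  (forall f, P (val f) = val f + S f) ->
  (forall x, ip (P x) (P x) <= 2 * ip x (P x)) ->
  selfadjoint_norm1_extension dot S (fun x => P x - x).
Proof.
move=> lP sP PS Ple; apply: contraction_extension.
- by move=> c x y; rewrite lP scalerBr opprD addrACA.
- by move=> x y; rewrite !ipE sP.
- exact: shift_contraction.
- by move=> f; rewrite PS addrC addrA addNr add0r.
Qed.

Lemma bound_of_two_extensions T1 T2 u :
  selfadjoint_norm1_extension dot S T1 ->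
  selfadjoint_norm1_extension dot S T2 ->
  forall f, defect f <= 1 ->
  rnorm (dot (S f) (T1 u - T2 u)) ^+ 2 <= 4 * ip u u.
Proof.
move=> e1 e2 f f1.
have u0 := ip_ge0 norm_dot u.
have bound T h : selfadjoint_norm1_extension dot S T ->
    (ip (val h) u - ip (S h) (T u)) ^+ 2 <= defect h * ip u u.
  move=> eT; have [lT _ _ TS] := eT.
  have Tle := extension_contraction eT.
  have := defect_cauchy_schwarz (val h) u lT Tle.
  rewrite TS -defectE => /le_trans; apply.
  by rewrite ler_wpM2l ?defect_ge0// gerBl ip_ge0.
apply: rnorm_dot_le => c; rewrite -linearZ /=.
have := bound _ (c *: f) e1; have := bound _ (c *: f) e2.
rewrite defectZ ipBr.
set a := ip (val _) _; set b2 := ip _ (T2 u); set b1 := ip _ (T1 u) => h2 h1.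
have : rnorm c ^+ 2 * defect f * ip u u <= ip u u * rnorm c ^+ 2.
  rewrite mulrAC (mulrC (ip u u)) -[leRHS]mulr1.
  by rewrite ler_wpM2l// mulr_ge0// sqr_ge0.
(* [(b1 - b2)^2 + (b1 + b2 - 2 a)^2 = 2 (a - b1)^2 + 2 (a - b2)^2], whence the factor 4. *)
have := sqr_ge0 (b1 + b2 - 2 * a); nra.
Qed.

(** The defect may vanish, so [f] is normalised by [defect f + e] before [e] tends to 0. *)
Lemma homogeneous_bound g M :
  (forall f, defect f <= 1 -> rnorm (dot (S f) g) ^+ 2 <= M) ->
  forall f, rnorm (dot (S f) g) ^+ 2 <= M * defect f.
Proof.
move=> bM f.
have M0 : 0 <= M.
  apply: le_trans (bM 0 _); rewrite ?sqr_ge0//.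
  by rewrite /defect linear0 /rnorm !normr0 real_part0 subrr.
apply: (@ler_linear_eps _ _ _ M) => e e0 _; rewrite -mulrDr.
have f0 := defect_ge0 f; have fe : 0 < defect f + e by lra.
pose r := Num.sqrt (defect f + e)^-1.
have r2 : rnorm (of_real k r) ^+ 2 = (defect f + e)^-1.
  by rewrite rnorm_of_real real_normK ?num_real// sqr_sqrtr// invr_ge0 ltW.
have := bM (of_real k r *: f).
rewrite defectZ linearZ /= dotZl rnormM exprMn r2 !ler_pdivrMl// mulr1.
rewrite (mulrC M).
by apply; rewrite lerDl ltW.
Qed.

Lemma rank_one_perturbation P g M :
  linear P -> (forall x y, ip (P x) y = ip x (P y)) ->
  (forall f, P (val f) = val f + S f) ->
  (forall x, ip (P x) (P x) <= 2 * ip x (P x)) ->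
  (forall x e, 0 < e -> exists f,
     ip x (P x) <= 2 * ip x (val f + S f) - ip (val f) (val f + S f) + e) ->
  orthogonal_complement dot D g -> 0 <= M ->
  (forall f, rnorm (dot (S f) g) ^+ 2 <= M * defect f) ->
  selfadjoint_norm1_extension dot S
    (fun x => P x + (of_real k (ip g g + M + 1)^-1 * dot x g) *: g - x).
Proof.
move=> lP sP PS Ple Pmin gD M0 gM.
have g0 := ip_ge0 norm_dot g.
(* The summand 1 keeps the denominator positive even when [g] and [M] vanish. *)
have c0 : 0 < ip g g + M + 1 by lra.
set e := _^-1; have e0 : 0 < e by rewrite invr_gt0.
pose C x := (of_real k e * dot x g) *: g.
have Cform x : ip x (C x) = e * rnorm (dot x g) ^+ 2.
  by rewrite /C -scalerA ipZr /ip dotZr -sqr_rnorm_scalar.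
have lPC : linear (fun x => P x + C x).
  move=> c x y; rewrite lP scalerDr addrACA; congr (_ + _).
  by rewrite /C dotDl dotZl mulrDr scalerDl scalerA mulrCA.
have sPC x y : ip (P x + C x) y = ip x (P y + C y).
  rewrite !ipE sP; congr (_ + _).
  rewrite /C -!scalerA ipZl ipZr; congr (_ * _).
  by rewrite /ip dotZl dotZr -dotC mulrC.
apply: (@extension_of_form (fun x => P x + C x)) => //.
  by move=> f; rewrite PS /C gD mulr0 scale0r addr0.
apply: form_bound_contraction => //.
  move=> x; rewrite ipDr Cform addr_ge0 ?(mulr_ge0 (ltW e0)) ?sqr_ge0//.
  by have := Ple x; have := ip_ge0 norm_dot (P x); lra.
move=> x; apply/ler_addgt0Pr => d d0; rewrite ipDr Cform.
have [f fP] := Pmin x d d0.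
suff : e * rnorm (dot x g) ^+ 2 <=
    2 * ip x x - 2 * ip x (val f + S f) + ip (val f) (val f + S f).
  by move: fP; lra.
(* Completing the square: as [g] is orthogonal to [f], twice [dot x g] is [dot w g + dot (S f) g],
   controlled by [ip w w] and by the defect. *)
pose w := of_real k 2 *: x - (val f + S f).
have wE : 2 * ip x x - 2 * ip x (val f + S f) + ip (val f) (val f + S f) =
    (ip w w + defect f) / 2.
  rewrite defectE /w !ipE (ipC dot (val f) x) (ipC dot (S f) x).
  by rewrite (ipC dot (S f) (val f)); lra.
have tri : 2 * rnorm (dot x g) <= rnorm (dot w g) + rnorm (dot (S f) g).
  have -> : 2 * rnorm (dot x g) = rnorm (dot w g + dot (S f) g).
    rewrite /w dotDl dotZl dotNl dotDl gD add0r subrK rnormM rnorm_of_real.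
    by rewrite ger0_norm.
  exact: rnormD.
have wg : rnorm (dot w g) ^+ 2 <= ip w w * ip g g.
  rewrite !(ip_sqr norm_dot) -exprMn ler_pXn2r ?nnegrE ?mulr_ge0 ?rnorm_ge0//.
  exact: rnorm_dot.
rewrite wE mulrC ler_pdivrMr//.
have := gM f; have := defect_ge0 f; have := ip_ge0 norm_dot w.
have := rnorm_ge0 (dot x g).
move: tri wg; set p := rnorm _; set q := rnorm _; set r := rnorm _.
set W := ip w w; set G := ip g g in g0 *; set d' := defect f.
move=> tri wg p0 W0 d'0 rd.
have p4 : 4 * p ^+ 2 <= 2 * q ^+ 2 + 2 * r ^+ 2.
  by have := sqr_ge0 (q - r); nra.
have h1 : W * G <= W * (G + M + 1) by rewrite ler_wpM2l//; lra.
have h2 : M * d' <= d' * (G + M + 1) by rewrite mulrC ler_wpM2l//; lra.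
lra.
Qed.

End Extension.
End Contractions.

Theorem theorem7p7 (R : realType) (k : scalar_kind)
  (H : completeNormedModType (scalars R k))
  (dot : {dot H for @scalar_conj R k})
  (norm_dot : forall x : H, `|x| ^+ 2 = dot x x)
  (D : submodClosed H) (S : {linear subspace_type D -> H})
  (S_symmetric : symmetric_on dot S) (S_norm1 : opnorm S = 1%E) :
  (exists! T : H -> H, selfadjoint_norm1_extension dot S T) <->
  (forall g : H, orthogonal_complement dot D g -> g != 0 ->
    ereal_sup [set ((rnorm (dot (S f) g)) ^+ 2)%:E |
      f in [set f : subspace_type D | rnorm f ^+ 2 - rnorm (S f) ^+ 2 <= 1]]
    = +oo%E).
Proof.
split=> [[T [eT uniqT]] g gD g0|unbounded].
  apply/ereal_sup_image_pinfty => -[M bM].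
  have [P [lP sP PS Ple Pmin]] := extension_krein norm_dot S_symmetric S_norm1.
  have M0 : 0 <= M.
    apply: le_trans (bM 0 _); rewrite ?sqr_ge0//=.
    by rewrite linear0 /rnorm !normr0 real_part0 subrr.
  have gM := homogeneous_bound S_norm1 bM.
  have e1 := extension_of_form norm_dot S_norm1 lP sP PS Ple.
  have e2 := rank_one_perturbation norm_dot S_norm1 lP sP PS Ple Pmin gD M0 gM.
  (* At [g] the two extensions differ by a positive multiple of [g]. *)
  have := congr1 (fun F => F g) (etrans (esym (uniqT _ e1)) (uniqT _ e2)).
  move=> /(addIr _) /= /eqP; rewrite -[X in X == _]addr0 => /eqP/addrI/esym/eqP.
  rewrite scaler_eq0 (negPf g0) orbF -norm_dot mulf_eq0 expf_eq0 normr_eq0.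
  rewrite (negPf g0) andbF orbF => /eqP e0.
  have := @of_realK R k (ip dot g g + M + 1)^-1; rewrite e0 real_part0.
  have gg := ip_ge0 norm_dot g.
  by move=> /eqP; rewrite eq_sym invr_eq0 gt_eqF//; lra.
have [P [lP sP PS Ple _]] := extension_krein norm_dot S_symmetric S_norm1.
pose T0 x := P x - x.
have eT : selfadjoint_norm1_extension dot S T0 by exact: extension_of_form.
exists T0; split=> // T eT'; apply/funext => u.
apply/eqP; rewrite -subr_eq0; apply/negP => /negP w0.
have [_ aT _ TS] := eT; have [_ aT' _ TS'] := eT'.
(* Moving both operators onto [f] turns each into [S f]. *)
have gD : orthogonal_complement dot D (T0 u - T u).
  by move=> f; rewrite dotBr -aT -aT' TS TS' subrr.
have /ereal_sup_image_pinfty := unbounded _ gD w0; apply.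
exists (4 * ip dot u u) => f.
exact: (bound_of_two_extensions norm_dot S_norm1 u eT eT').
Qed.
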